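(* For every integer $m \geq 1$, the Bernoulli number $B_{2m}$ has the integral representation $$B_{2m} = \frac{(-1)^{m-1}}{2^{2m+1}} \int_{-\infty}^{+\infty} \left( \frac{d^{m-1}}{dx^{m-1}} \operatorname{sech}^2 x \right)^2 dx.$$
   Context: The Bernoulli numbers $B_k$ ($k \geq 0$) are defined by the generating function $\frac{z}{e^z-1} = \sum_{k=0}^{\infty} \frac{B_k}{k!} z^k$ (so $B_0 = 1$, $B_1 = -\frac12$, $B_2 = \frac16$, $B_4 = -\frac1{30}$). Here $\operatorname{sech} x = 1/\cosh x$, and the derivative of order $0$ of a function is the function itself. *)

(* Defs.v *)
From Stdlib Require Import Reals Factorial Arith Lra Lia.
From Coquelicot Require Import Coquelicot.

Open Scope R_scope.

(* The generating function is required on a punctured neighbourhood of 0,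
   because in Rocq z / (exp z - 1) takes the value 0, not 1, at z = 0. *)
Definition is_bernoulli (B : nat -> R) : Prop :=
  locally' 0 (fun z : R =>
    is_pseries (fun k : nat => B k / INR (fact k)) z (z / (exp z - 1))).

Definition sech (x : R) : R := / cosh x.

(* Everything below only serves [is_bernoulli_exists], i.e. that [is_bernoulli]
   is satisfiable. The coefficients c_n = B_n / n! solve
   (sum_n c_n z^n) * (sum_n z^n / (n+1)!) = 1, a recurrence whose solution is
   bounded by 1, so the power series converges for |z| < 1.
   [bern_aux n k] is c_k for k <= n. *)

Fixpoint bern_aux (n : nat) : nat -> R :=
  match n with
  | O => fun _ => 1
  | S p => fun k =>
      if (k <=? p)%nat then bern_aux p k
      else - sum_f_R0 (fun j => bern_aux p j * / INR (fact (S (S p - j)))) p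
  end.

Definition bern_coef (n : nat) : R := bern_aux n n.

Lemma bern_aux_eq (n k : nat) : (k <= n)%nat -> bern_aux n k = bern_coef k.
Proof.
induction n as [|n IH]; intros Hk.
- now replace k with 0%nat by lia.
- destruct (Nat.eq_dec k (S n)) as [->|Hne]; [easy|].
  simpl. destruct (Nat.leb_spec k n); [apply IH; lia | lia].
Qed.

Lemma bern_coefS (n : nat) :
  bern_coef (S n)
  = - sum_f_R0 (fun j => bern_coef j * / INR (fact (S (S n - j)))) n.
Proof.
unfold bern_coef at 1. cbn [bern_aux].
destruct (Nat.leb_spec (S n) n); [lia|].
f_equal. apply sum_eq. intros i Hi. now rewrite bern_aux_eq.
Qed.

Lemma bern_coef_rec (n : nat) :
  sum_f_R0 (fun j => bern_coef j * / INR (fact (S (S n - j)))) (S n) = 0.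
Proof.
rewrite tech5, bern_coefS, Nat.sub_diag. simpl. lra.
Qed.

Lemma inv_fact_le (i : nat) : / INR (fact (S i)) <= (/ 2) ^ i.
Proof.
rewrite pow_inv.
apply Rinv_le_contravar; [apply pow_lt; lra|].
induction i as [|i IH]; [simpl; lra|].
change (fact (S (S i))) with (S (S i) * fact (S i))%nat.
rewrite mult_INR. change (2 ^ S i) with (2 * 2 ^ i).
apply Rmult_le_compat; try lra; [apply pow_le; lra|].
rewrite !S_INR. pose proof (pos_INR i). lra.
Qed.

Lemma sum_half (n : nat) : sum_f_R0 (fun j => (/ 2) ^ (S n - j)) n <= 1.
Proof.
enough (H : sum_f_R0 (fun j => (/ 2) ^ (S n - j)) n = 1 - (/ 2) ^ (S n)).
{ rewrite H. pose proof (pow_lt (/ 2) (S n) ltac:(lra)). lra. }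
induction n as [|n IH]; [simpl; lra|].
rewrite tech5.
replace (S (S n) - S n)%nat with 1%nat by lia.
rewrite (sum_eq _ (fun j => (/ 2) ^ (S n - j) * / 2)).
- rewrite <- scal_sum, IH. simpl. field.
- intros i Hi. replace (S (S n) - i)%nat with (S (S n - i)) by lia.
  simpl. ring.
Qed.

Lemma bern_coef_le1 (n : nat) : Rabs (bern_coef n) <= 1.
Proof.
induction n as [n IH] using (well_founded_induction lt_wf).
destruct n as [|n].
- unfold bern_coef; simpl. rewrite Rabs_R1. lra.
- rewrite bern_coefS, Rabs_Ropp.
  eapply Rle_trans; [apply sum_f_R0_triangle|].
  eapply Rle_trans; [|apply (sum_half n)].
  apply sum_Rle. intros j Hj.
  assert (Hf := Rinv_0_lt_compat _ (INR_fact_lt_0 (S (S n - j)))).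
  rewrite Rabs_mult, (Rabs_pos_eq (/ _)) by lra.
  pose proof (inv_fact_le (S n - j)).
  pose proof (IH j ltac:(lia)).
  pose proof (Rabs_pos (bern_coef j)). nra.
Qed.

Lemma bern_coef_cv (z : R) :
  Rabs z < 1 -> Rbar_lt (Rabs z) (CV_radius bern_coef).
Proof.
intros Hz. eapply Rbar_lt_le_trans with (y := Finite 1); [exact Hz|].
apply CV_radius_bounded. exists 1. intros n.
rewrite pow1, Rmult_1_r. apply bern_coef_le1.
Qed.

Lemma inv_fact_cv : CV_radius (fun k => / INR (fact (S k))) = p_infty.
Proof.
change (CV_radius (PS_decr_1 (fun k => / INR (fact k))) = p_infty).
rewrite CV_radius_decr_1. apply CV_radius_infinite_DAlembert.
- intros n. apply Rinv_neq_0_compat, INR_fact_neq_0.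
- apply is_lim_seq_Reals. exact Alembert_exp.
Qed.

Lemma is_bernoulli_exists : exists B : nat -> R, is_bernoulli B.
Proof.
exists (fun k => bern_coef k * INR (fact k)).
exists (mkposreal 1 Rlt_0_1). intros z Hz Hz0.
assert (Hz1 : Rabs z < 1).
{ rewrite <- (Rminus_0_r z). exact Hz. }
assert (Hc := CV_radius_inside _ _ (bern_coef_cv z Hz1)).
apply PSeries_correct in Hc.
assert (He : is_pseries (fun k => / INR (fact (S k))) z ((exp z - 1) / z)).
{ replace ((exp z - 1) / z)
    with (scal (/ z) (plus (exp z) (opp (/ INR (fact 0))))).
  - apply (is_pseries_decr_1 (fun k => / INR (fact k)) z (/ z) (exp z)).
    + now apply Rinv_l.
    + apply is_exp_Reals.
  - unfold scal, plus, opp; simpl; unfold mult; simpl. field. exact Hz0. }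
assert (Hm := is_pseries_mult _ _ _ _ _ Hc He (bern_coef_cv z Hz1)
                ltac:(rewrite inv_fact_cv; exact I)).
assert (H1 : PSeries bern_coef z * ((exp z - 1) / z) = 1).
{ unfold Rdiv in *. rewrite <- (is_pseries_unique _ _ _ Hm).
  rewrite PSeries_decr_1 by (eexists; exact Hm).
  rewrite (PSeries_ext _ (fun _ => 0)), PSeries_const_0.
  - unfold PS_mult, bern_coef; simpl.
    change (@eq R (1 * / 1 + z * 0) 1). field.
  - intros n. apply bern_coef_rec. }
apply (is_pseries_ext bern_coef).
- intros k.
  change (@eq R (bern_coef k) (bern_coef k * INR (fact k) / INR (fact k))).
  field. apply INR_fact_neq_0.
- replace (z / (exp z - 1)) with (PSeries bern_coef z); [exact Hc|].
  assert (exp z - 1 <> 0).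
  { intros E. rewrite E in H1. unfold Rdiv in H1. lra. }
  apply (Rmult_eq_reg_r ((exp z - 1) / z)).
  + rewrite H1. now field.
  + intros E. rewrite E in H1. lra.
Qed.

(* Main.v *)
Require Import Defs.
From Stdlib Require Import Reals Arith Lra Lia.
From Coquelicot Require Import Coquelicot.

Open Scope R_scope.

(** With the sigmoid [s(x) = 1 / (1 + exp (-2x))] one has [s' = 2 s (1 - s)] and
    [sech^2 = 4 s (1 - s)]. Hence, for the polynomials [Q_0 = s],
    [Q_(n+1) = s (1 - s) Q_n'] (here [sigmoid_poly]), the derivative of order
    [m - 1] of [sech^2] is [2^(m+1) Q_m(s(x))]. Substituting [s] for [x] turns the
    integral of its square into [2^(2m+1)] times the integral of [Q_(m-1)' Q_m]
    over [0, 1] ([is_RInt_gen_sigmoid_poly_sqr]), and integrating by parts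
    [m - 1] times moves all derivatives to one side:
    [(-1)^(m-1)] times the integral of [Q_(2m-1)] ([parts_iter]).

    It remains to see that the integral [b_n] of [Q_n] over [0, 1] is [B_(n+1)]
    for [n >= 1]. Both sequences are determined by the value of
    [sum_(j < n) C(n, j) u_j]. For the Bernoulli numbers this is the recurrence
    given by the generating function ([binom_transform_bernoulli]). For the
    [b_n], it comes from the identity
    [s * sum_(j <= n) C(n, j) Q_j = s - (1 - s) Q_n] ([sigmoid_poly_binom]):
    its integral is a recurrence for [b], which Pascal's rule turns into the
    Bernoulli recurrence for the sequence [1, b_0, b_1, ...]
    ([binom_transform_bernoulli_plus]). As [b_0 = 1/2] this is the sequence of
    Bernoulli numbers with the sign of [B_1] reversed. *)

(** * Binomial transforms *)

Lemma C_n_0 (n : nat) : Binomial.C n 0 = 1.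
Proof.
unfold Binomial.C. rewrite Nat.sub_0_r. simpl (fact 0).
rewrite INR_1, Rmult_1_l. apply Rinv_r, INR_fact_neq_0.
Qed.

Lemma C_n_n (n : nat) : Binomial.C n n = 1.
Proof.
unfold Binomial.C. rewrite Nat.sub_diag. simpl (fact 0).
rewrite INR_1, Rmult_1_r. apply Rinv_r, INR_fact_neq_0.
Qed.

Definition binom_transform (u : nat -> R) (n : nat) : R :=
  sum_f_R0 (fun j => Binomial.C n j * u j) n.

Lemma binom_transformS (u : nat -> R) (n : nat) :
  binom_transform u (S n)
  = binom_transform u n + binom_transform (fun j => u (S j)) n.
Proof.
unfold binom_transform.
destruct n as [|n].
- simpl. rewrite !C_n_0, C_n_n. ring.
- rewrite decomp_sum by lia. cbn [Init.Nat.pred].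
  rewrite (decomp_sum (fun j => Binomial.C (S n) j * u j)) by lia.
  cbn [Init.Nat.pred].
  rewrite !C_n_0, !tech5, !C_n_n.
  rewrite (sum_eq _ (fun i => Binomial.C (S n) (S i) * u (S i)
                              + Binomial.C (S n) i * u (S i))).
  + rewrite sum_plus. ring.
  + intros i Hi. rewrite <- pascal by lia. ring.
Qed.

Lemma binom_transform_ext (u v : nat -> R) (n : nat) :
  (forall j, u j = v j) -> binom_transform u n = binom_transform v n.
Proof.
intros H. apply sum_eq. intros i _. now rewrite H.
Qed.

Lemma binom_transform_minus (u v : nat -> R) (n : nat) :
  binom_transform (fun j => u j - v j) n
  = binom_transform u n - binom_transform v n.
Proof.
unfold binom_transform. rewrite <- minus_sum.
apply sum_eq. intros i _. ring.
Qed.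

(** Subtracting [u n] leaves the terms of index [j < n], and among these
    [u (n - 1)] has the nonzero coefficient [n]. *)
Lemma binom_transform_inj (u v : nat -> R) :
  (forall n, binom_transform u n - u n = binom_transform v n - v n) ->
  forall n, u n = v n.
Proof.
intros H n.
induction n as [n IH] using (well_founded_induction lt_wf).
assert (Hn := H (S n)). unfold binom_transform in Hn.
rewrite !tech5, C_n_n in Hn.
assert (Hc : Binomial.C (S n) n <> 0).
{ unfold Binomial.C, Rdiv. apply Rmult_integral_contrapositive_currified.
  - apply INR_fact_neq_0.
  - apply Rinv_neq_0_compat, Rmult_integral_contrapositive_currified;
      apply INR_fact_neq_0. }
apply (Rmult_eq_reg_l (Binomial.C (S n) n)); [|exact Hc].
destruct n as [|n].
- simpl in Hn. lra.
- rewrite !(tech5 _ n) in Hn.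
  rewrite (sum_eq _ (fun j => Binomial.C (S (S n)) j * v j)) in Hn.
  + lra.
  + intros i Hi. rewrite (IH i) by lia. reflexivity.
Qed.

Lemma binom_transform_delta1 (n : nat) :
  binom_transform (fun j => if (j =? 1)%nat then 1 else 0) n = INR n.
Proof.
assert (Hz : forall k, binom_transform (fun _ => 0) k = 0).
{ intros k. unfold binom_transform.
  rewrite (sum_eq _ (fun _ => 0)) by (intros; ring).
  rewrite sum_cte. ring. }
assert (Ho : forall k,
  binom_transform (fun j => if (S j =? 1)%nat then 1 else 0) k = 1).
{ induction k as [|k IH].
  - unfold binom_transform, Binomial.C. simpl. field.
  - rewrite binom_transformS, IH. simpl. rewrite Hz. ring. }
induction n as [|n IH].
- unfold binom_transform. simpl. ring.
- rewrite binom_transformS, IH, Ho, S_INR. ring.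
Qed.

(** * The Bernoulli recurrence *)

Lemma is_bernoulli_radius (B : nat -> R) :
  is_bernoulli B -> Rbar_lt 0 (CV_radius (fun k => B k / INR (fact k))).
Proof.
intros [d Hd].
assert (Hp := cond_pos d).
assert (Hs : is_pseries (fun k => B k / INR (fact k)) (d / 2)
               (d / 2 / (exp (d / 2) - 1))).
{ apply Hd; [|lra].
  change (Rabs (d / 2 - 0) < d).
  rewrite Rminus_0_r, Rabs_pos_eq; lra. }
apply Rbar_lt_le_trans with (y := Finite (Rabs (d / 2))).
- simpl. apply Rabs_pos_lt. lra.
- apply Rbar_not_lt_le. intros Hlt.
  apply (CV_disk_outside _ _ Hlt).
  apply ex_series_lim_0. eexists.
  apply is_pseries_R. exact Hs.
Qed.

(** Multiplying by [z], as below, makes the identity of power series hold at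
    [z = 0] too, where the generating function takes a default value. *)
Lemma bernoulli_rec (B : nat -> R) (n : nat) :
  is_bernoulli B ->
  sum_f_R0 (fun j => B j / INR (fact j) * / INR (fact (S (n - j)))) n
  = if (n =? 0)%nat then 1 else 0.
Proof.
intros HB.
set (a := fun k => B k / INR (fact k)).
set (e := fun k => / INR (fact (S k))).
set (one := fun k : nat => if (k =? 0)%nat then 1 else 0).
change (PS_mult a e n = one n).
change (PS_incr_1 (PS_mult a e) (S n) = PS_incr_1 one (S n)).
assert (Ha : Rbar_lt 0 (CV_radius a)) by now apply is_bernoulli_radius.
assert (He : CV_radius e = p_infty) by exact inv_fact_cv.
assert (Hone : Rbar_le 1 (CV_radius one)).
{ apply CV_radius_bounded. exists 1. intros k.
  rewrite pow1, Rmult_1_r. unfold one.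
  destruct (k =? 0)%nat; rewrite ?Rabs_R1, ?Rabs_R0; lra. }
apply PSeries_ext_recip.
- rewrite CV_radius_incr_1. eapply Rbar_lt_le_trans; [exact Ha|].
  apply Rbar_not_lt_le. intros Hlt.
  (* A radius of the product below that of [a] would contradict the
     convergence of the product at a point between the two. *)
  assert (Hex : exists r : R, Rbar_lt (CV_radius (PS_mult a e)) r
                              /\ Rbar_lt r (CV_radius a) /\ 0 <= r).
  { assert (H0 := CV_radius_ge_0 (PS_mult a e)).
    destruct (CV_radius (PS_mult a e)) as [p| |]; try easy.
    destruct (CV_radius a) as [q| |]; simpl in *; try easy.
    - exists ((p + q) / 2). simpl in *. lra.
    - exists (p + 1). simpl in *. lra. }
  destruct Hex as (r & H1 & H2 & H3).
  assert (Hr : Rabs r = r) by now apply Rabs_pos_eq.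
  apply (CV_disk_outside (PS_mult a e) r).
  + now rewrite Hr.
  + apply ex_series_lim_0.
    destruct (ex_pseries_mult a e r) as [l Hl].
    * now rewrite Hr.
    * now rewrite He.
    * exists l. now apply is_pseries_R.
- rewrite CV_radius_incr_1. eapply Rbar_lt_le_trans; [|exact Hone].
  simpl. lra.
- destruct HB as [d Hd].
  assert (Hloc : exists r : posreal, Rbar_le r (CV_radius a)).
  { destruct (CV_radius a) as [q| |]; try easy.
    - exists (mkposreal q Ha). simpl. lra.
    - exists (mkposreal 1 Rlt_0_1). exact I. }
  destruct Hloc as [r Hr].
  assert (Hm : 0 < Rmin 1 (Rmin d r)).
  { repeat apply Rmin_pos; try apply cond_pos. lra. }
  exists (mkposreal _ Hm). intros z Hz.
  assert (Hz' : Rabs z < Rmin 1 (Rmin d r)).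
  { rewrite <- (Rminus_0_r z). exact Hz. }
  apply Rmin_Rgt_l in Hz'. destruct Hz' as [Hz1 Hz'].
  apply Rmin_Rgt_l in Hz'. destruct Hz' as [Hzd Hzr].
  rewrite !PSeries_incr_1.
  destruct (Req_dec z 0) as [->|Hz0]; [ring|].
  f_equal.
  assert (Hza : Rbar_lt (Rabs z) (CV_radius a)).
  { eapply Rbar_lt_le_trans; [|exact Hr]. exact Hzr. }
  rewrite PSeries_mult; [|exact Hza|now rewrite He].
  transitivity 1.
  + assert (HA : PSeries a z = z / (exp z - 1)).
    { apply is_pseries_unique, Hd; [|exact Hz0].
      change (Rabs (z - 0) < d). now rewrite Rminus_0_r. }
    assert (HE : exp z = 1 + z * PSeries e z).
    { rewrite <- (is_pseries_unique _ _ _ (is_exp_Reals z)).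
      rewrite PSeries_decr_1 by (eexists; apply is_exp_Reals).
      simpl (fact 0). rewrite INR_1, Rinv_1. reflexivity. }
    rewrite HA, HE.
    assert (z * PSeries e z <> 0).
    { assert (exp z <> 1); [|lra].
      intros E. apply Hz0, exp_inv. now rewrite exp_0. }
    field. lra.
  + rewrite PSeries_decr_1.
    * rewrite (PSeries_ext _ (fun _ => 0)), PSeries_const_0; [|easy].
      unfold one. simpl. ring.
    * apply CV_radius_inside. eapply Rbar_lt_le_trans; [|exact Hone].
      exact Hz1.
Qed.

Lemma binom_transform_bernoulli (B : nat -> R) (n : nat) :
  is_bernoulli B ->
  binom_transform B n - B n = if (n =? 1)%nat then 1 else 0.
Proof.
intros HB. destruct n as [|n].
- unfold binom_transform, Binomial.C. simpl. field.
- unfold binom_transform. rewrite tech5.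
  rewrite C_n_n.
  rewrite (sum_eq _ (fun j => B j / INR (fact j) * / INR (fact (S (n - j)))
                              * INR (fact (S n)))).
  + rewrite <- scal_sum, bernoulli_rec by exact HB.
    destruct n as [|n]; simpl; ring.
  + intros j Hj. unfold Binomial.C.
    replace (S n - j)%nat with (S (n - j)) by lia.
    field. split; apply INR_fact_neq_0.
Qed.

(** * Polynomial functions *)

(** The closure under extensional equality makes the class stable under
    [Derive] without functional extensionality. *)
Inductive poly_fun : (R -> R) -> Prop :=
| poly_const c : poly_fun (fun _ => c)
| poly_id : poly_fun (fun x => x)
| poly_plus f g : poly_fun f -> poly_fun g -> poly_fun (fun x => f x + g x)
| poly_mult f g : poly_fun f -> poly_fun g -> poly_fun (fun x => f x * g x)
| poly_ext f g : (forall x, f x = g x) -> poly_fun f -> poly_fun g.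

Lemma poly_fun_derive (f : R -> R) :
  poly_fun f -> exists g, poly_fun g /\ forall x, is_derive f x (g x).
Proof.
induction 1 as [c| |f g Hf [f' [Pf Df]] Hg [g' [Pg Dg]]
                   |f g Hf [f' [Pf Df]] Hg [g' [Pg Dg]]|f g E Hf [f' [Pf Df]]].
- exists (fun _ => 0). split; [constructor|].
  intros x. exact (is_derive_const c x).
- exists (fun _ => 1). split; [constructor|].
  intros x. exact (is_derive_id x).
- exists (fun x => f' x + g' x). split; [now constructor|].
  intros x. exact (is_derive_plus f g x _ _ (Df x) (Dg x)).
- exists (fun x => f' x * g x + f x * g' x).
  split; [repeat (constructor; try easy)|].
  intros x.
  exact (is_derive_mult f g x _ _ (Df x) (Dg x) Rmult_comm).
- exists f'. split; [easy|].
  intros x. now apply (is_derive_ext f).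
Qed.

Lemma poly_fun_ex_derive (f : R -> R) (x : R) : poly_fun f -> ex_derive f x.
Proof.
intros Hf. destruct (poly_fun_derive f Hf) as [g [_ Hg]]. now exists (g x).
Qed.

Lemma poly_fun_Derive (f : R -> R) : poly_fun f -> poly_fun (Derive f).
Proof.
intros Hf. destruct (poly_fun_derive f Hf) as [g [Pg Hg]].
apply (poly_ext g); [|exact Pg].
intros x. symmetry. now apply is_derive_unique.
Qed.

Lemma poly_fun_continuous (f : R -> R) (x : R) : poly_fun f -> continuous f x.
Proof.
intros Hf. now apply (ex_derive_continuous f), poly_fun_ex_derive.
Qed.

Lemma poly_fun_ex_RInt (f : R -> R) (a b : R) : poly_fun f -> ex_RInt f a b.
Proof.
intros Hf. apply (ex_RInt_continuous f). intros x _.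
now apply poly_fun_continuous.
Qed.

Lemma RInt_plus_poly (f g : R -> R) (a b : R) :
  poly_fun f -> poly_fun g ->
  RInt (fun x => f x + g x) a b = RInt f a b + RInt g a b.
Proof.
intros Hf Hg.
apply (RInt_plus (V := R_CompleteNormedModule) f g);
  now apply poly_fun_ex_RInt.
Qed.

Lemma RInt_scal_poly (f : R -> R) (c a b : R) :
  poly_fun f -> RInt (fun x => c * f x) a b = c * RInt f a b.
Proof.
intros Hf. apply (RInt_scal (V := R_CompleteNormedModule) f).
now apply poly_fun_ex_RInt.
Qed.

Lemma RInt_Derive_poly (f : R -> R) (a b : R) :
  poly_fun f -> RInt (Derive f) a b = f b - f a.
Proof.
intros Hf. apply RInt_Derive; intros x _.
- now apply poly_fun_ex_derive.
- now apply poly_fun_continuous, poly_fun_Derive.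
Qed.

Lemma RInt_parts_poly (f g : R -> R) (a b : R) :
  poly_fun f -> poly_fun g ->
  RInt (fun x => Derive f x * g x) a b
  = f b * g b - f a * g a - RInt (fun x => f x * Derive g x) a b.
Proof.
intros Hf Hg.
assert (Hf' := poly_fun_Derive f Hf). assert (Hg' := poly_fun_Derive g Hg).
assert (E := RInt_Derive_poly (fun x => f x * g x) a b (poly_mult f g Hf Hg)).
assert (S := RInt_plus_poly (fun x => Derive f x * g x)
               (fun x => f x * Derive g x) a b
               ltac:(now constructor) ltac:(now constructor)).
rewrite (RInt_ext _ (Derive (fun x => f x * g x))) in S.
- rewrite E in S. simpl in *. lra.
- intros x _. symmetry. apply Derive_mult; now apply poly_fun_ex_derive.
Qed.

Lemma poly_fun_sum (q : nat -> R -> R) (c : nat -> R) (n : nat) :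
  (forall j, poly_fun (q j)) ->
  poly_fun (fun x => sum_f_R0 (fun j => c j * q j x) n).
Proof.
intros Hq. induction n as [|n IH]; simpl.
- now repeat constructor.
- apply poly_plus; [exact IH|]. now repeat constructor.
Qed.

Lemma Derive_binom_transform (q : nat -> R -> R) (n : nat) (x : R) :
  (forall j, poly_fun (q j)) ->
  Derive (fun y => binom_transform (fun j => q j y) n) x
  = binom_transform (fun j => Derive (q j) x) n.
Proof.
intros Hq. unfold binom_transform. generalize (Binomial.C n). intros c.
induction n as [|n IH]; simpl.
- apply Derive_scal.
- rewrite Derive_plus, IH, Derive_scal; [reflexivity| |].
  + now apply poly_fun_ex_derive, poly_fun_sum.
  + apply poly_fun_ex_derive. now repeat constructor.
Qed.

Lemma RInt_binom_transform (q : nat -> R -> R) (n : nat) (a b : R) :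
  (forall j, poly_fun (q j)) ->
  RInt (fun x => binom_transform (fun j => q j x) n) a b
  = binom_transform (fun j => RInt (q j) a b) n.
Proof.
intros Hq. unfold binom_transform. generalize (Binomial.C n). intros c.
induction n as [|n IH]; simpl.
- now apply RInt_scal_poly.
- rewrite <- IH, <- RInt_scal_poly by easy.
  apply RInt_plus_poly.
  + now apply poly_fun_sum.
  + now repeat constructor.
Qed.

(** * The derivatives of the logistic function as polynomials *)

(** If [s' = s (1 - s)], as for the logistic function, then the derivative of
    order [n] of [s] is [sigmoid_poly n] at [s]. *)
Fixpoint sigmoid_poly (n : nat) : R -> R :=
  match n with
  | O => fun s => s
  | S p => fun s => s * (1 - s) * Derive (sigmoid_poly p) s
  end.

Lemma poly_fun_sigmoid (n : nat) : poly_fun (sigmoid_poly n).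
Proof.
induction n as [|n IH]; simpl.
- constructor.
- apply (poly_mult (fun s => s * (1 - s))).
  + apply (poly_ext (fun s => s * (1 + (-1) * s))); [intros; ring|].
    repeat constructor.
  + now apply poly_fun_Derive.
Qed.

Lemma sigmoid_poly_at0 (n : nat) : sigmoid_poly n 0 = 0.
Proof. destruct n; simpl; ring. Qed.

Lemma sigmoid_polyS_at1 (n : nat) : sigmoid_poly (S n) 1 = 0.
Proof. simpl; ring. Qed.

(** For the logistic function [s(y)], Leibniz's rule says that the sum is
    [exp (-y)] times the derivative of order [n] of [exp y * s(y)], which is
    [exp y - s(y)]; hence it is [1 - exp (-y) Q_n(s(y))], and
    [s(y) exp (-y) = 1 - s(y)]. The induction on polynomials below avoids the
    exponential. *)
Lemma sigmoid_poly_binom (n : nat) (s : R) :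
  s * binom_transform (fun j => sigmoid_poly j s) n
  = s - (1 - s) * sigmoid_poly n s.
Proof.
revert s. induction n as [|n IH]; intros s.
- unfold binom_transform, Binomial.C. simpl. field.
- set (T := fun y => binom_transform (fun j => sigmoid_poly j y) n) in *.
  assert (HT : poly_fun T) by (apply poly_fun_sum, poly_fun_sigmoid).
  assert (HQ := poly_fun_sigmoid n).
  rewrite binom_transformS. fold (T s).
  assert (E : binom_transform (fun j => sigmoid_poly (S j) s) n
              = s * (1 - s) * Derive T s).
  { unfold T. rewrite Derive_binom_transform by apply poly_fun_sigmoid.
    unfold binom_transform. rewrite scal_sum.
    apply sum_eq. intros i _. simpl. ring. }
  rewrite E.
  assert (D : T s + s * Derive T s
              = 1 + sigmoid_poly n s - (1 - s) * Derive (sigmoid_poly n) s).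
  { assert (DL : is_derive (fun y => y * T y) s (1 * T s + s * Derive T s)).
    { apply (is_derive_mult (fun y => y) T s 1 (Derive T s)).
      - apply (is_derive_id s).
      - now apply Derive_correct, poly_fun_ex_derive.
      - exact Rmult_comm. }
    assert (DR : is_derive (fun y => y - (1 - y) * sigmoid_poly n y) s
              (1 - (- 1 * sigmoid_poly n s
                    + (1 - s) * Derive (sigmoid_poly n) s))).
    { auto_derive; [now apply poly_fun_ex_derive|].
      change (fun x => sigmoid_poly n x) with (sigmoid_poly n). ring. }
    apply (is_derive_ext _ (fun y => y * T y)) in DR;
      [|intros y; symmetry; apply IH].
    apply is_derive_unique in DL. apply is_derive_unique in DR.
    assert (U := eq_trans (eq_sym DL) DR). lra. }
  assert (IHs := IH s). fold (T s) in IHs.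
  cbn [sigmoid_poly].
  transitivity (s * (s * T s) + s * (1 - s) * (T s + s * Derive T s)); [ring|].
  rewrite D, IHs. ring.
Qed.

(** * Integrals of the polynomials are Bernoulli numbers *)

(** Away from [s = 0] one may divide [sigmoid_poly_binom] by [s]. The term
    [(1 - s) Q_(n+1) / s] becomes [(1 - s)^2 Q_n'], which is
    [(1 - s) Q_n' - Q_(n+1)]; the first part is integrated by parts, by means of
    the explicit antiderivative [s - (1 - s) Q_n] of [1 + Q_n - (1 - s) Q_n']. *)
Lemma binom_transform_RInt_sigmoid (n : nat) :
  binom_transform (fun j => RInt (sigmoid_poly j) 0 1) (S n)
  = 1 - RInt (sigmoid_poly n) 0 1 + RInt (sigmoid_poly (S n)) 0 1.
Proof.
rewrite <- RInt_binom_transform by apply poly_fun_sigmoid.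
set (Q := sigmoid_poly n).
assert (PQ : poly_fun Q) by apply poly_fun_sigmoid.
assert (PS : poly_fun (sigmoid_poly (S n))) by apply poly_fun_sigmoid.
assert (PD : poly_fun (fun s => s + (-1) * ((1 + (-1) * s) * Q s))).
{ repeat constructor; exact PQ. }
rewrite (RInt_ext _ (fun s =>
  Derive (fun s => s + (-1) * ((1 + (-1) * s) * Q s)) s
  + ((-1) * Q s + sigmoid_poly (S n) s))).
- rewrite (RInt_plus_poly (Derive _) (fun s => (-1) * Q s + sigmoid_poly (S n) s)).
  + rewrite RInt_Derive_poly by exact PD.
    rewrite (RInt_plus_poly (fun s => (-1) * Q s)), RInt_scal_poly;
      [|exact PQ|now repeat constructor|exact PS].
    unfold Q. rewrite sigmoid_poly_at0. ring.
  + now apply poly_fun_Derive.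
  + apply (poly_plus (fun s => (-1) * Q s)); [now repeat constructor|exact PS].
- intros s [Hs _]. rewrite Rmin_left in Hs by lra.
  assert (E := sigmoid_poly_binom (S n) s).
  assert (D : Derive (fun s => s + (-1) * ((1 + (-1) * s) * Q s)) s
              = 1 + Q s - (1 - s) * Derive Q s).
  { apply is_derive_unique. auto_derive; [now apply poly_fun_ex_derive|].
    change (fun x => Q x) with Q. ring. }
  rewrite D.
  apply (Rmult_eq_reg_l s); [|lra].
  rewrite E. simpl. fold Q. ring.
Qed.

(** The Bernoulli numbers with [1/2] in place of [-1/2] as the term of
    index 1. *)
Definition bernoulli_plus (n : nat) : R :=
  match n with
  | O => 1
  | S p => RInt (sigmoid_poly p) 0 1
  end.

Lemma binom_transform_bernoulli_plus (n : nat) :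
  binom_transform bernoulli_plus n - bernoulli_plus n = INR n.
Proof.
assert (H0 : RInt (sigmoid_poly 0) 0 1 = 1 / 2).
{ simpl. apply is_RInt_unique.
  replace (1 / 2) with (minus (1 ^ 2 / 2) (0 ^ 2 / 2))
    by (unfold minus, plus, opp; simpl; field).
  apply (is_RInt_derive (fun x => x ^ 2 / 2) (fun x => x)).
  - intros x _. auto_derive; [easy|]. field.
  - intros x _. apply continuous_id. }
induction n as [|n IH].
- unfold binom_transform, Binomial.C. simpl. field.
- rewrite binom_transformS, S_INR, <- IH.
  change (fun j => bernoulli_plus (S j))
    with (fun j => RInt (sigmoid_poly j) 0 1).
  destruct n as [|n].
  + unfold binom_transform, Binomial.C. cbn [sum_f_R0 bernoulli_plus].
    rewrite H0. simpl. field.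
  + rewrite binom_transform_RInt_sigmoid. simpl. ring.
Qed.

Lemma bernoulli_RInt_sigmoid (B : nat -> R) (n : nat) :
  is_bernoulli B -> B (S (S n)) = RInt (sigmoid_poly (S n)) 0 1.
Proof.
intros HB.
rewrite (binom_transform_inj B
  (fun j => bernoulli_plus j - if (j =? 1)%nat then 1 else 0)).
- simpl. ring.
- intros k. rewrite binom_transform_bernoulli by exact HB.
  rewrite binom_transform_minus, binom_transform_delta1.
  assert (E := binom_transform_bernoulli_plus k). lra.
Qed.

(** Each step moves the derivative off the left factor [Q_(k+1)], and then the
    factor [s (1 - s)] of [Q_(k+1)] to the right; boundary terms vanish because
    [s (1 - s)] divides them. *)
Lemma parts_iter (k j : nat) :
  RInt (fun s => Derive (sigmoid_poly k) s * sigmoid_poly (S j) s) 0 1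
  = (-1) ^ k * RInt (sigmoid_poly (S (j + k))) 0 1.
Proof.
revert j. induction k as [|k IH]; intros j.
- rewrite Nat.add_0_r, Rmult_1_l. apply RInt_ext. intros s _.
  change (Derive (sigmoid_poly 0) s) with (Derive (fun x => x) s).
  rewrite Derive_id. apply Rmult_1_l.
- rewrite RInt_parts_poly by apply poly_fun_sigmoid.
  rewrite !sigmoid_polyS_at1, !sigmoid_poly_at0.
  replace (S (j + S k)) with (S (S j + k)) by lia.
  rewrite (RInt_ext (fun s => sigmoid_poly (S k) s * Derive (sigmoid_poly (S j)) s)
    (fun s => Derive (sigmoid_poly k) s * sigmoid_poly (S (S j)) s)).
  + rewrite IH. simpl. ring.
  + intros s _. apply Rminus_diag_uniq. cbn [sigmoid_poly]. ring.
Qed.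

(** * The change of variable *)

(** This is the logistic function at [2 x], that is [(1 + tanh x) / 2]. *)
Definition sigmoid2 (x : R) : R := / (1 + exp (- 2 * x)).

Lemma is_derive_sigmoid2 (x : R) :
  is_derive sigmoid2 x (2 * (sigmoid2 x * (1 - sigmoid2 x))).
Proof.
unfold sigmoid2. assert (H := exp_pos (- 2 * x)).
auto_derive; [lra|]. field. lra.
Qed.

Lemma sech_sqr (x : R) : sech x ^ 2 = 4 * (sigmoid2 x * (1 - sigmoid2 x)).
Proof.
unfold sech, cosh, sigmoid2.
replace (- 2 * x) with (- x + - x) by ring.
rewrite exp_plus, exp_Ropp.
assert (H := exp_pos x). field. split; nra.
Qed.

Lemma is_derive_poly_sigmoid2 (f : R -> R) (x : R) :
  ex_derive f (sigmoid2 x) ->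
  is_derive (fun y => f (sigmoid2 y)) x
    (2 * (sigmoid2 x * (1 - sigmoid2 x)) * Derive f (sigmoid2 x)).
Proof.
intros Hf.
apply (is_derive_comp f sigmoid2).
- now apply Derive_correct.
- apply is_derive_sigmoid2.
Qed.

Lemma Derive_n_sech_sqr (n : nat) (x : R) :
  Derive_n (fun t => sech t ^ 2) n x
  = 2 ^ (n + 2) * sigmoid_poly (S n) (sigmoid2 x).
Proof.
revert x. induction n as [|n IH]; intros x.
- cbn [Derive_n sigmoid_poly]. rewrite sech_sqr.
  rewrite Derive_id. simpl. ring.
- cbn [Derive_n]. rewrite (Derive_ext _ _ _ IH), Derive_scal.
  rewrite (is_derive_unique (fun y : R => sigmoid_poly (S n) (sigmoid2 y)) _ _
    (is_derive_poly_sigmoid2 (sigmoid_poly (S n)) x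
      (poly_fun_ex_derive _ _ (poly_fun_sigmoid (S n))))).
  replace (S n + 2)%nat with (S (n + 2)) by lia.
  change (sigmoid_poly (S (S n)) (sigmoid2 x))
    with (sigmoid2 x * (1 - sigmoid2 x)
          * Derive (sigmoid_poly (S n)) (sigmoid2 x)).
  cbn [pow]. ring.
Qed.

Lemma sigmoid2_lim_p : filterlim sigmoid2 (Rbar_locally p_infty) (locally 1).
Proof.
change (is_lim sigmoid2 p_infty 1).
assert (L : is_lim (fun x => exp (- 2 * x)) p_infty 0).
{ apply (is_lim_comp exp _ p_infty 0 m_infty).
  - exact is_lim_exp_m.
  - replace m_infty with (Rbar_mult (- 2) p_infty).
    + apply is_lim_scal_l, is_lim_id.
    + apply is_Rbar_mult_unique. apply is_Rbar_mult_sym.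
      apply is_Rbar_mult_p_infty_neg. simpl. lra.
  - now exists 0. }
replace (Finite 1) with (Rbar_inv (1 + 0)) by (simpl; f_equal; field).
apply is_lim_inv.
- apply (is_lim_plus' (fun _ => 1)); [apply is_lim_const|exact L].
- simpl. injection. lra.
Qed.

Lemma sigmoid2_opp (x : R) : sigmoid2 (- x) = 1 - sigmoid2 x.
Proof.
unfold sigmoid2. replace (- 2 * - x) with (- (- 2 * x)) by ring.
rewrite exp_Ropp. assert (H := exp_pos (- 2 * x)). field. lra.
Qed.

Lemma sigmoid2_lim_m : filterlim sigmoid2 (Rbar_locally m_infty) (locally 0).
Proof.
change (is_lim sigmoid2 m_infty 0).
apply (is_lim_ext (fun x => 1 - sigmoid2 (- x))).
{ intros x. rewrite sigmoid2_opp. ring. }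
replace (Finite 0) with (Finite (1 - 1)) by (f_equal; ring).
apply (is_lim_minus' (fun _ => 1)); [apply is_lim_const|].
apply (is_lim_comp sigmoid2 Ropp m_infty 1 p_infty).
- exact sigmoid2_lim_p.
- apply (is_lim_opp (fun x => x) m_infty m_infty), is_lim_id.
- now exists 0.
Qed.

(** An antiderivative is half of [H(s(x))], where [H' = Q_n' Q_(n+1)]: the factor
    [2 s (1 - s)] from the chain rule turns [Q_n'] into [2 Q_(n+1)]. *)
Lemma is_RInt_gen_sigmoid_poly_sqr (n : nat) :
  is_RInt_gen (fun x => sigmoid_poly (S n) (sigmoid2 x) ^ 2)
    (Rbar_locally m_infty) (Rbar_locally p_infty)
    (/ 2 * RInt (fun s => Derive (sigmoid_poly n) s * sigmoid_poly (S n) s) 0 1).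
Proof.
set (h := fun s => Derive (sigmoid_poly n) s * sigmoid_poly (S n) s).
assert (Ph : poly_fun h).
{ apply poly_mult; [|apply poly_fun_sigmoid].
  apply poly_fun_Derive, poly_fun_sigmoid. }
set (H := fun u => / 2 * RInt h 0 u).
assert (DH : forall u, is_derive H u (/ 2 * h u)).
{ intros u. unfold H. apply is_derive_scal.
  apply (is_derive_RInt h (fun u => RInt h 0 u) 0 u).
  - apply filter_forall. intros y.
    now apply (RInt_correct h), poly_fun_ex_RInt.
  - now apply poly_fun_continuous. }
assert (CH : forall u, filterlim H (locally u) (locally (H u))).
{ intros u. apply (ex_derive_continuous H). eexists. apply DH. }
set (g := fun x => sigmoid_poly (S n) (sigmoid2 x) ^ 2).
assert (DG : forall x, is_derive (fun y => H (sigmoid2 y)) x (g x)).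
{ intros x. evar_last.
  - apply is_derive_poly_sigmoid2. eexists. apply DH.
  - rewrite (is_derive_unique _ _ _ (DH (sigmoid2 x))).
    unfold h, g. cbn [sigmoid_poly]. field. }
assert (CG : forall x, continuous g x).
{ intros x. unfold g. apply (ex_derive_continuous
    (fun x => sigmoid_poly (S n) (sigmoid2 x) ^ 2)).
  apply (ex_derive_comp (fun u => u ^ 2)).
  - auto_derive. easy.
  - eexists. apply is_derive_poly_sigmoid2, poly_fun_ex_derive, poly_fun_sigmoid. }
assert (EG : forall x, Derive (fun y => H (sigmoid2 y)) x = g x).
{ intros x. now apply is_derive_unique. }
apply (is_RInt_gen_ext (Derive (fun y => H (sigmoid2 y)))).
{ apply filter_forall. intros ab x _. apply EG. }
replace (/ 2 * RInt h 0 1) with (H 1 - H 0).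
2: { unfold H. rewrite RInt_point. unfold zero; simpl. ring. }
apply is_RInt_gen_Derive.
- apply filter_forall. intros ab x _. eexists. apply DG.
- apply filter_forall. intros ab x _.
  apply (continuous_ext g); [|apply CG].
  intros y. symmetry. apply EG.
- eapply filterlim_comp; [exact sigmoid2_lim_m|apply CH].
- eapply filterlim_comp; [exact sigmoid2_lim_p|apply CH].
Qed.

Theorem mainTheorem1 (B : nat -> R) (hB : is_bernoulli B)
    (m : nat) (hm : (1 <= m)%nat) :
  let f := fun x : R => (Derive_n (fun t : R => sech t ^ 2) (m - 1) x) ^ 2 in
  ex_RInt_gen f (Rbar_locally m_infty) (Rbar_locally p_infty) /\
  B (2 * m)%nat =
    (-1) ^ (m - 1) / 2 ^ (2 * m + 1) *
    RInt_gen f (Rbar_locally m_infty) (Rbar_locally p_infty).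
Proof.
intros f.
destruct m as [|n]; [lia|].
unfold f; clear f. replace (S n - 1)%nat with n by lia.
set (f := fun x => Derive_n (fun t => sech t ^ 2) n x ^ 2).
set (c := (2 ^ (n + 2)) ^ 2).
assert (I : is_RInt_gen f (Rbar_locally m_infty) (Rbar_locally p_infty)
              (c * (/ 2 * ((-1) ^ n * B (2 * S n)%nat)))).
{ replace (2 * S n)%nat with (S (S (n + n))) by lia.
  rewrite (bernoulli_RInt_sigmoid B (n + n) hB), <- parts_iter.
  apply (is_RInt_gen_ext (fun x =>
    scal c (sigmoid_poly (S n) (sigmoid2 x) ^ 2))).
  - apply filter_forall. intros ab x _. unfold f, c.
    rewrite Derive_n_sech_sqr, Rpow_mult_distr. reflexivity.
  - apply (is_RInt_gen_scal (V := R_NormedModule)).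
    apply is_RInt_gen_sigmoid_poly_sqr. }
split; [eexists; exact I|].
rewrite (is_RInt_gen_unique _ _ I).
assert (S1 : (-1) ^ n * (-1) ^ n = 1).
{ rewrite <- Rpow_mult_distr. replace (-1 * -1) with 1 by ring. apply pow1. }
assert (Hc : c = 2 * 2 ^ (2 * S n + 1)).
{ unfold c. rewrite <- pow_mult.
  replace ((n + 2) * 2)%nat with (S (2 * S n + 1)) by lia. reflexivity. }
rewrite Hc.
transitivity (((-1) ^ n * (-1) ^ n) * B (2 * S n)%nat).
- rewrite S1. ring.
- field. apply pow_nonzero. lra.
Qed.
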